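(* The axiom system $\mathcal{S}$ consisting of (R1), (R2), (R3), (R4), (R5), (R6), (R8), (R8$'$), (R10) is equivalent to Tarski's system (R1)--(R10). That is, an algebra $\mathfrak{A}=(A,+,-,;,{}^{\smile},1')$ satisfies all axioms of $\mathcal{S}$ if and only if it satisfies all of (R1)--(R10).
   Context: All algebras have the form $\mathfrak{A}=(A,+,-,;,{}^{\smile},1')$, where $A$ is a non-empty set, $+$ and $;$ are binary operations on $A$, $-$ and ${}^{\smile}$ are unary operations on $A$, and $1'$ is a distinguished element of $A$. Unary operations bind more tightly than binary ones, and $;$ binds more tightly than $+$. An algebra satisfies an axiom if the axiom holds for all elements $r,s,t\in A$. The axioms are: (R1) $r+s=s+r$; (R2) $r+(s+t)=(r+s)+t$; (R3) $-(-r+s)+-(-r+-s)=r$; (R4) $r;(s;t)=(r;s);t$; (R5) $r;1'=r$; (R6) $(r^{\smile})^{\smile}=r$; (R7) $(r;s)^{\smile}=s^{\smile};r^{\smile}$; (R8) $(r+s);t=r;t+s;t$; (R9) $(r+s)^{\smile}=r^{\smile}+s^{\smile}$; (R10) $r^{\smile};-(r;s)+-s=-s$, i.e. $\bigl((r^{\smile});(-(r;s))\bigr)+(-s)=-s$; and the left-hand distributive law (R8$'$) $r;(s+t)=r;s+r;t$. So $\mathcal{S}$ is obtained from (R1)--(R10) by adding (R8$'$) and dropping (R7) and (R9). *)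

(* Defs.v *)
(** Algebras of the signature (A, +, -, ;, converse, 1'), with no axioms imposed.
    The carrier is automatically non-empty: it contains [ident]. *)
Record algebra : Type := Algebra {
  carrier :> Type;
  add : carrier -> carrier -> carrier;
  compl : carrier -> carrier;
  comp : carrier -> carrier -> carrier;
  conv : carrier -> carrier;
  ident : carrier
}.

Arguments add {_} _ _.
Arguments compl {_} _.
Arguments comp {_} _ _.
Arguments conv {_} _.
Arguments ident {_}.

Declare Scope relalg_scope.
Delimit Scope relalg_scope with relalg.

(* Unary operations bind tighter than [;;], which binds tighter than [+].
   [- r] is the unary (Boolean) complement. *)
Notation "r + s" := (add r s) : relalg_scope.
Notation "- r" := (compl r) : relalg_scope.
Notation "r ;; s" := (comp r s) (at level 40, left associativity) : relalg_scope.
Notation "r ^conv" := (conv r) (at level 1, left associativity, format "r ^conv")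
  : relalg_scope.
Notation "1'" := ident : relalg_scope.

Local Open Scope relalg_scope.

Definition ax_R1 (A : algebra) : Prop := forall r s : A, r + s = s + r.

Definition ax_R2 (A : algebra) : Prop :=
  forall r s t : A, r + (s + t) = (r + s) + t.

Definition ax_R3 (A : algebra) : Prop :=
  forall r s : A, - (- r + s) + - (- r + - s) = r.

Definition ax_R4 (A : algebra) : Prop :=
  forall r s t : A, r ;; (s ;; t) = (r ;; s) ;; t.

Definition ax_R5 (A : algebra) : Prop := forall r : A, r ;; 1' = r.

Definition ax_R6 (A : algebra) : Prop := forall r : A, (r^conv)^conv = r.

Definition ax_R7 (A : algebra) : Prop :=
  forall r s : A, (r ;; s)^conv = s^conv ;; r^conv.

Definition ax_R8 (A : algebra) : Prop :=
  forall r s t : A, (r + s) ;; t = r ;; t + s ;; t.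

Definition ax_R8' (A : algebra) : Prop :=
  forall r s t : A, r ;; (s + t) = r ;; s + r ;; t.

Definition ax_R9 (A : algebra) : Prop :=
  forall r s : A, (r + s)^conv = r^conv + s^conv.

Definition ax_R10 (A : algebra) : Prop :=
  forall r s : A, r^conv ;; - (r ;; s) + - s = - s.

Definition satisfies_Tarski (A : algebra) : Prop :=
  ax_R1 A /\ ax_R2 A /\ ax_R3 A /\ ax_R4 A /\ ax_R5 A /\
  ax_R6 A /\ ax_R7 A /\ ax_R8 A /\ ax_R9 A /\ ax_R10 A.

Definition satisfies_S (A : algebra) : Prop :=
  ax_R1 A /\ ax_R2 A /\ ax_R3 A /\ ax_R4 A /\ ax_R5 A /\
  ax_R6 A /\ ax_R8 A /\ ax_R8' A /\ ax_R10 A.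

(* Main.v *)
(** Write [r <= s] for [r + s = s].  Axioms (R6), (R8') and (R10) say that
    [x |-> r ;; x] and [x |-> r^conv ;; x] are conjugate operators:
    [r ;; s <= - t] iff [r^conv ;; t <= - s].  Taking [1'] as an argument and
    using (R5), [r^conv <= - t] iff [r ;; t <= - 1'].  As [t] ranges over all
    elements this determines [r^conv], so that (R9) follows from monotonicity of
    [;;] and (R7) from associativity.  Conversely, (R8') is the image of (R8)
    under the anti-automorphism [conv]. *)
Require Import Defs.
From Stdlib Require Import Setoid.

Local Open Scope relalg_scope.

Definition le {A : algebra} (r s : A) : Prop := r + s = s.

Notation "r <= s" := (le r s) : relalg_scope.

Section Huntington.

Context {A : algebra} (R1 : ax_R1 A) (R2 : ax_R2 A) (R3 : ax_R3 A).

Lemma add_swap (r s t : A) : r + (s + t) = s + (r + t).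
Proof. now rewrite R2, (R1 r s), <- R2. Qed.

(** Splitting [x] and [- x] along [y] by (R3) gives a sum of four terms; exchanging [x] and [y] only
    permutes them. *)
Lemma add_compl_const (r s : A) : r + - r = s + - s.
Proof.
  assert (Hexp : forall x y : A, x + - x =
      (- (- x + - y) + - (- x + - - y)) + (- (- - x + - y) + - (- - x + - - y))).
  { intros x y. now rewrite !R3. }
  rewrite (Hexp r s), (Hexp s r).
  rewrite (R1 (- s) (- r)), (R1 (- s) (- - r)),
    (R1 (- - s) (- r)), (R1 (- - s) (- - r)), <- !R2.
  now rewrite (add_swap (- (- r + - - s))).
Qed.

(** Split [- - r] along [- r] and [r] along [- - r] by (R3). The two sums share the term
    [- (- r + - - - r)], and the other terms agree by [add_compl_const]. *)
Lemma compl_involutive (r : A) : - - r = r.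
Proof.
  transitivity (- (- - - r + - r) + - (- - - r + - - r)).
  { symmetry. apply R3. }
  rewrite (R1 (- - - r) (- - r)), (add_compl_const (- - r) (- r)).
  rewrite (R1 (- - - r) (- r)), R1. apply R3.
Qed.

Lemma add_idem (r : A) : r + r = r.
Proof.
  (* [u] is the top element. Once [u + u = u] is known, [- u] is idempotent and hence neutral for
     [+], and [Hdouble] at [- r] gives idempotence. *)
  set (u := r + - r).
  assert (Hu : forall x : A, x + - x = u) by (intro x; apply add_compl_const).
  assert (Hdouble : forall x : A, - (- x + - x) + - u = x).
  { intro x. rewrite <- (R3 x (- x)) at 3.
    now rewrite (Hu (- x)). }
  assert (Hz : - u + - (u + u) = - u).
  { pose proof (Hdouble (- u)) as H. rewrite compl_involutive in H.
    now rewrite R1. }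
  assert (Huu : u + u = u).
  { transitivity (u + (u + - (u + u))).
    - f_equal. rewrite <- (Hu u) at 1. rewrite <- Hz at 1.
      now rewrite R2, Hu.
    - rewrite R2. apply Hu. }
  assert (Hzz : - u + - u = - u) by (rewrite Huu in Hz; exact Hz).
  assert (H0 : forall x : A, x + - u = x).
  { intro x. rewrite <- (Hdouble x) at 1. now rewrite <- R2, Hzz. }
  pose proof (Hdouble (- r)) as H. rewrite H0, compl_involutive in H.
  rewrite <- (compl_involutive (r + r)), H. apply compl_involutive.
Qed.

Lemma le_refl (r : A) : r <= r.
Proof. apply add_idem. Qed.

Lemma le_trans (r s t : A) : r <= s -> s <= t -> r <= t.
Proof. unfold le. intros H K. now rewrite <- K, R2, H. Qed.

Lemma le_antisym (r s : A) : r <= s -> s <= r -> r = s.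
Proof. unfold le. intros H K. now rewrite <- H, R1. Qed.

Lemma le_add_l (r s : A) : r <= r + s.
Proof. unfold le. now rewrite R2, add_idem. Qed.

Lemma le_add_r (r s : A) : s <= r + s.
Proof. rewrite R1. apply le_add_l. Qed.

Lemma add_le (r s t : A) : r <= t -> s <= t -> r + s <= t.
Proof. unfold le. intros H K. now rewrite <- R2, K. Qed.

Lemma compl_antitone (r s : A) : r <= s -> - s <= - r.
Proof.
  unfold le. intro H.
  rewrite <- (R3 (- r) s), compl_involutive, H. apply le_add_l.
Qed.

Lemma le_compl_sym (r s : A) : r <= - s <-> s <= - r.
Proof.
  split; intro H; apply compl_antitone in H;
    now rewrite compl_involutive in H.
Qed.

Lemma eq_of_le_compl (r s : A) :
  (forall t : A, r <= - t <-> s <= - t) -> r = s.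
Proof.
  intro H. apply le_antisym.
  - rewrite <- (compl_involutive s). apply H.
    rewrite compl_involutive. apply le_refl.
  - rewrite <- (compl_involutive r). apply H.
    rewrite compl_involutive. apply le_refl.
Qed.

End Huntington.

Section Conjugation.

Context {A : algebra} (HS : satisfies_S A).

Let R1 : ax_R1 A. Proof. apply HS. Qed.
Let R2 : ax_R2 A. Proof. apply HS. Qed.
Let R3 : ax_R3 A. Proof. apply HS. Qed.
Let R4 : ax_R4 A. Proof. apply HS. Qed.
Let R5 : ax_R5 A. Proof. apply HS. Qed.
Let R6 : ax_R6 A. Proof. apply HS. Qed.
Let R8 : ax_R8 A. Proof. apply HS. Qed.
Let R8' : ax_R8' A. Proof. apply HS. Qed.
Let R10 : ax_R10 A. Proof. apply HS. Qed.

Lemma comp_mono_l (r s t : A) : r <= s -> r ;; t <= s ;; t.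
Proof. unfold le. intro H. now rewrite <- R8, H. Qed.

Lemma comp_mono_r (r s t : A) : s <= t -> r ;; s <= r ;; t.
Proof. unfold le. intro H. now rewrite <- R8', H. Qed.

(** The hypothesis gives [t <= - (r ;; s)]; multiply by [r^conv] on the left and apply (R10). By
    (R6) the reverse implication is the same one at [r^conv]. *)
Lemma comp_conjugate (r s t : A) : r ;; s <= - t <-> r^conv ;; t <= - s.
Proof.
  assert (Himp : forall x y z : A, x ;; y <= - z -> x^conv ;; z <= - y).
  { intros x y z H. apply (le_trans R2) with (x^conv ;; - (x ;; y)).
    - apply comp_mono_r. now apply (le_compl_sym R1 R2 R3).
    - apply R10. }
  split; intro H.
  - now apply Himp.
  - apply Himp in H. now rewrite R6 in H.
Qed.

Lemma conv_le_compl (r t : A) : r^conv <= - t <-> r ;; t <= - 1'.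
Proof. now rewrite comp_conjugate, R5. Qed.

Lemma conv_mono (r s : A) : r <= s -> r^conv <= s^conv.
Proof.
  intro H. rewrite <- (compl_involutive R1 R2 R3 (s^conv)).
  apply conv_le_compl. apply (le_trans R2) with (s ;; - s^conv).
  - now apply comp_mono_l.
  - apply conv_le_compl. rewrite (compl_involutive R1 R2 R3).
    apply (le_refl R1 R2 R3).
Qed.

Lemma conv_comp : ax_R7 A.
Proof.
  (* Both sides lie below [- t] exactly when [s ;; t <= - r^conv]: on the left, move [r] across in
     [r ;; (s ;; t) <= - 1']; on the right, move [s]. *)
  intros r s. apply (eq_of_le_compl R1 R2 R3). intro t.
  rewrite conv_le_compl, <- R4, comp_conjugate, R5.
  rewrite (le_compl_sym R1 R2 R3). apply comp_conjugate.
Qed.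

Lemma conv_add : ax_R9 A.
Proof.
  intros r s. apply (le_antisym R1).
  (* A monotone involution is an order automorphism, so it preserves joins: it suffices that
     [(r^conv + s^conv)^conv] bounds [r] and [s]. *)
  - rewrite <- (R6 (r^conv + s^conv)). apply conv_mono. apply (add_le R2).
    + rewrite <- (R6 r) at 1. apply conv_mono, (le_add_l R1 R2 R3).
    + rewrite <- (R6 s) at 1. apply conv_mono, (le_add_r R1 R2 R3).
  - apply (add_le R2); apply conv_mono.
    + apply (le_add_l R1 R2 R3).
    + apply (le_add_r R1 R2 R3).
Qed.

End Conjugation.

Lemma comp_add_r_of_conv {A : algebra} :
  ax_R6 A -> ax_R7 A -> ax_R8 A -> ax_R9 A -> ax_R8' A.
Proof.
  intros R6 R7 R8 R9 r s t.
  now rewrite <- (R6 (r ;; (s + t))), R7, R9, R8, R9, !R7, !R6.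
Qed.

Theorem theorem4 (A : algebra) : satisfies_S A <-> satisfies_Tarski A.
Proof.
  split.
  - intro HS. pose proof (conv_comp HS). pose proof (conv_add HS).
    unfold satisfies_S in HS. unfold satisfies_Tarski. tauto.
  - intros (R1 & R2 & R3 & R4 & R5 & R6 & R7 & R8 & R9 & R10).
    pose proof (comp_add_r_of_conv R6 R7 R8 R9).
    unfold satisfies_S. tauto.
Qed.
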